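(* Let $\nu=(\nu^1,\dots,\nu^k)$ be a tuple of vertical strips and let $G_\nu[X;q]$ be the associated vertical strip LLT polynomial. Then $G_\nu[X;q+1]$ (the symmetric function obtained from $G_\nu[X;q]$ by the substitution $q\mapsto q+1$) is $e$-positive.
   Context: $\Lambda$ is the algebra of symmetric functions in $x_1,x_2,\dots$ over $\mathbb{Q}(q,t)$; $e_r$ is the elementary symmetric function of degree $r$ and $e_\mu=e_{\mu_1}e_{\mu_2}\cdots$ for a partition $\mu$. The $e_\mu$ form a basis of $\Lambda$. A symmetric function $f\in\Lambda$ is called $e$-positive if all coefficients of its expansion in the basis $\{e_\mu\}_\mu$ lie in $\mathbb{N}[q,t]$, where $0 \in \mathbb{N}$. Cells are unit squares in the plane (French convention) indexed by their positions: a cell in column $x$ and row $y$ ($x,y$ positive integers, rows numbered from bottom to top). A vertical strip is a skew Young diagram consisting of finitely many consecutive cells in a single column, i.e. the cells in column $x$ and rows $y,y+1,\dots,y+h-1$ for some $x,y,h$. The position of the strip matters, through contents: the content of a cell $u$ in row $y$ and column $x$ is $c(u)=y-x$. A semistandard filling of a vertical strip is a filling of its cells with positive integers that is strictly increasing from bottom to top; the set of these fillings of a strip $\rho$ is $SSYT(\rho)$. For a tuple $\nu=(\nu^1,\dots,\nu^k)$ of vertical strips, $SSYT(\nu)=SSYT(\nu^1)\times\cdots\times SSYT(\nu^k)$. For $T=(T^1,\dots,T^k)\in SSYT(\nu)$, let $\mathbf{x}^T=\prod_{i=1}^k\prod_{u\in\nu^i}x_{T^i(u)}$. Two entries $T^i(u)<T^j(v)$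 (with $u\in\nu^i$, $v\in\nu^j$) form an inversion if either $i<j$ and $c(u)=c(v)$, or $i>j$ and $c(v)=c(u)+1$. Let $\mathrm{inv}(T)$ be the total number of inversions of $T$. The vertical strip LLT polynomial is $$G_\nu[X;q]=\sum_{T\in SSYT(\nu)}q^{\mathrm{inv}(T)}\mathbf{x}^T ,$$ which is known to be a symmetric function, i.e. an element of $\Lambda$. *)

(* Defs.v *)
From HB Require Import structures.
From mathcomp Require Import all_boot all_order all_algebra.
From mathcomp Require Import finmap mpoly.

Set Implicit Arguments.
Unset Strict Implicit.
Unset Printing Implicit Defensive.

Import Order.TTheory GRing.Theory Num.Theory.

Local Open Scope ring_scope.

Definition Qqt : fieldType := {fraction {mpoly rat[2]}}.

(* Q[q,t] is [{mpoly rat[2]}] with q = 'X_0 and t = 'X_1. *)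
Definition qvar : Qqt := FracField.tofrac ('X_0 : {mpoly rat[2]}).

(* Membership in N[q,t], seen inside Q(q,t). *)
Definition in_Nqt (a : Qqt) : Prop :=
  exists2 p : {mpoly rat[2]}, p \is a mpolyOver 2 Num.nat
                            & a = FracField.tofrac p.

(* Lambda is the graded inverse limit of the rings of symmetric polynomials in
   finitely many variables, so an element f is given by the sequence of its
   restrictions f(x_1, ..., x_n, 0, 0, ...); equality and the algebra
   operations of Lambda are those of the restrictions, for every n.
   The indeterminate ['X_i], [i : 'I_n], stands for x_{i+1}. *)
Definition varseq : Type := forall n : nat, {mpoly Qqt[n]}.

Definition is_partition (s : seq nat) : bool := sorted geq s && (0 \notin s)%N.

Record intpart : Type := IntPart {
  parts :> seq nat;
  _ : is_partition parts }.

HB.instance Definition _ := [isSub for parts].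
HB.instance Definition _ := [Choice of intpart by <:].

Definition e_part (mu : intpart) : varseq :=
  fun n => \prod_(r <- parts mu) mesym n Qqt r.

Definition e_expansion (f : varseq) (c : {fsfun intpart -> Qqt with 0}) : Prop :=
  forall n : nat, f n = \sum_(mu <- finsupp c) c mu *: e_part mu n.

(* The e_mu form a basis of Lambda, so [c] is the only expansion of [f]. *)
Definition e_positive (f : varseq) : Prop :=
  exists2 c : {fsfun intpart -> Qqt with 0},
    e_expansion f c & forall mu : intpart, in_Nqt (c mu).

(* The cells in column [vs_col] and rows [vs_row], ...,
   [vs_row + vs_height - 1]; the empty strip is allowed. *)
Record vstrip : Type := VStrip {
  vs_col : nat;
  vs_row : nat;
  vs_height : nat;
  vs_col_gt0 : (0 < vs_col)%N;
  vs_row_gt0 : (0 < vs_row)%N }.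

Section LLT.

Variables (k : nat) (nu : k.-tuple vstrip).

(* [Tagged _ a], with tag [i], is the cell of the i-th strip lying [a] rows
   above its bottom cell. *)
Definition cell : finType := {i : 'I_k & 'I_(vs_height (tnth nu i))}.

Definition content (u : cell) : int :=
  let s := tnth nu (tag u) in (vs_row s + tagged u)%N%:Z - (vs_col s)%:Z.

(* Fillings with entries in {1, ..., n}, the element [a : 'I_n] standing for
   the entry a + 1. *)
Definition filling (n : nat) : finType := {ffun cell -> 'I_n}.

Definition is_ssyt (n : nat) (T : filling n) : bool :=
  [forall i : 'I_k, forall a : 'I_(vs_height (tnth nu i)),
    forall b : 'I_(vs_height (tnth nu i)),
    (a < b)%N ==> (T (Tagged _ a) < T (Tagged _ b))%N].

Definition is_inversion (n : nat) (T : filling n) (u v : cell) : bool :=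
  (T u < T v)%N &&
  ((tag u < tag v)%N && (content u == content v)
   || (tag v < tag u)%N && (content v == content u + 1)).

Definition inv (n : nat) (T : filling n) : nat :=
  #|[set p : cell * cell | is_inversion T p.1 p.2]|.

(* G_nu[X; z]. Restricting to x_1, ..., x_n amounts to keeping the fillings
   with entries at most n. *)
Definition LLT (z : Qqt) : varseq := fun n =>
  \sum_(T : filling n | is_ssyt T) z ^+ inv T *: \prod_(u : cell) 'X_(T u).

End LLT.

(* Main.v *)
Require Import Defs.
From mathcomp Require Import all_boot all_order all_algebra.
From mathcomp Require Import finmap mpoly ring zify.

Set Implicit Arguments.
Unset Strict Implicit.
Unset Printing Implicit Defensive.

Import GRing.Theory Num.Theory.

Local Open Scope ring_scope.

(** Sweep the cells by increasing content, then by increasing strip index, and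
    keep in a FIFO queue the entries that can still form inversions with later
    cells. Each unit of time is one of three operators on weighted sums over
    queues: a new entry arrives (N), the oldest entry departs (E), or the oldest
    entry departs while a larger one, the next in the same strip, arrives (D);
    the LLT polynomial is the value of a word in N, E, D on the empty queue.
    With z the inversion parameter and words read in order of application,
    N E = E N + (z - 1) D, and D E = T E D with T a Hecke operator acting on
    the two oldest entries. T travels back through the word until it reaches the
    letters that created these two entries, where N N T = z N N, D N T = N D and
    N D T = (z - 1) N D + z D N. So every occurrence of E moves left, up to
    N D^a E = e_(a+1), and all coefficients are polynomials in z and z - 1 with
    natural coefficients; now take z = q + 1. *)

(** * Queue operators and their relations with the Hecke operator *)

Section QueueOperators.

Variables (A : comNzRingType) (n : nat) (z : A) (X : 'I_n -> A).
(* Queues are listed from the newest to the oldest element. *)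
Implicit Types (f g : seq 'I_n -> A) (s t : seq 'I_n) (a b c d x : 'I_n).

Definition arrival_weight x s : A := z ^+ count (fun y : 'I_n => y < x)%N s * X x.

(** Here [f s] stands for the total weight of the histories that end in the queue [s]. Each operator
    therefore looks back across the last event: a new entry is stripped off the front, and a
    departed one is put back at the far end and summed over. *)
Definition push f s : A :=
  if s is x :: s' then arrival_weight x s' * f s' else 0.

Definition pop f s : A := \sum_a f (rcons s a).

Definition exch f s : A :=
  if s is x :: s' then
    arrival_weight x s' * \sum_(a : 'I_n) (a < x)%N%:R * f (rcons s' a)
  else 0.

(* The entries of the Hecke operator on a pair with newer element [b] and older
   element [a]; its eigenvalues are [z] and [-1]. *)
Definition heckeD b a : A :=
  if (a < b)%N then z - 1 else if (b < a)%N then 0 else z.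

Definition heckeO b a : A :=
  if (a < b)%N then z else if (b < a)%N then 1 else 0.

Fixpoint hecke i f s {struct i} : A :=
  match i, s with
  | 0%N, b :: a :: s' =>
      heckeD b a * f (b :: a :: s') + heckeO b a * f (a :: b :: s')
  | j.+1, x :: s' => hecke j (fun t => f (x :: t)) s'
  | _, _ => 0
  end.

Lemma eq_hecke m i f g s :
  (forall t, size t = m -> f t = g t) -> size s = m -> hecke i f s = hecke i g s.
Proof.
elim: i m f g s => [|i IHi] m f g [|b s] //= fg sz; last first.
  by case: m sz fg => // m [sz] fg; apply: (IHi m) => // t st; apply: fg; rewrite /= st.
by case: s sz => // a s sz; rewrite !fg.
Qed.

Lemma hecke_cat f s b a t :
  hecke (size s) f (s ++ b :: a :: t) =
  heckeD b a * f (s ++ b :: a :: t) + heckeO b a * f (s ++ a :: b :: t).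
Proof. by elim: s f => [|x s IHs] f //=; rewrite IHs. Qed.

Lemma hecke_mull i (w : seq 'I_n -> A) f s :
    (forall t t', perm_eq t t' -> w t = w t') ->
  hecke i (fun t => w t * f t) s = w s * hecke i f s.
Proof.
elim: i w f s => [|i IHi] w f [|b s] wP /=; rewrite ?mulr0 //; last first.
  rewrite (IHi (fun t => w (b :: t))) // => t t' tt'; apply: wP.
  by rewrite perm_cons.
case: s => [|a s]; rewrite ?mulr0 //.
rewrite (wP (a :: b :: s) (b :: a :: s)); first by ring.
by apply/permP => p /=; rewrite addnCA.
Qed.

Lemma arrival_weight_perm x s t :
  perm_eq s t -> arrival_weight x s = arrival_weight x t.
Proof. by move=> /permP st; rewrite /arrival_weight st. Qed.

Lemma arrival_weight_rcons x s a :
  arrival_weight x (rcons s a) = z ^+ (a < x)%N * arrival_weight x s.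
Proof.
by rewrite /arrival_weight -cats1 count_cat /= addn0 exprD mulrCA mulrA.
Qed.

Lemma arrival_weight_cons x s a :
  arrival_weight x (a :: s) = z ^+ (a < x)%N * arrival_weight x s.
Proof. by rewrite /arrival_weight /= exprD mulrA. Qed.

(** The weight of an arrival depends only on the multiset of entries waiting, which the Hecke
    operator does not change. *)
Lemma hecke_push i f x s :
  hecke i.+1 (push f) (x :: s) = push (hecke i f) (x :: s).
Proof. by rewrite /= hecke_mull // => t t'; apply: arrival_weight_perm. Qed.

Lemma hecke_rcons i f s a : (i.+1 < size s)%N ->
  hecke i f (rcons s a) = hecke i (fun t => f (rcons t a)) s.
Proof.
elim: i f s => [|i IHi] f [|b [|c s]] //= si.
exact: (IHi (fun t => f (b :: t)) (c :: s)).
Qed.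

Lemma hecke_sum i (I : finType) (u : I -> A) (F : I -> seq 'I_n -> A) s :
  hecke i (fun t => \sum_j u j * F j t) s = \sum_j u j * hecke i (F j) s.
Proof.
elim: i F s => [|i IHi] F [|b s] //=; first by rewrite big1 // => j _; rewrite mulr0.
  case: s => [|a s]; first by rewrite big1 // => j _; rewrite mulr0.
  by rewrite !mulr_sumr -big_split; apply: eq_bigr => j _ /=; ring.
by rewrite big1 // => j _; rewrite mulr0.
Qed.

(** As for [push]; the bound keeps the Hecke operator away from the departing entry. *)
Lemma hecke_exch i f x s : (i.+1 < size s)%N ->
  hecke i.+1 (exch f) (x :: s) = exch (hecke i f) (x :: s).
Proof.
move=> si; rewrite /= hecke_mull; last by move=> t t'; apply: arrival_weight_perm.
congr (_ * _); rewrite hecke_sum; apply: eq_bigr => a _.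
by rewrite hecke_rcons.
Qed.

(** Whether the departing entry [a] is still present when [x] arrives matters only through z^[a < x]
    = 1 + (z - 1) [a < x]. *)
Lemma pop_push f x s :
  pop (push f) (x :: s) = push (pop f) (x :: s) + (z - 1) * exch f (x :: s).
Proof.
rewrite /pop /= !mulr_sumr -big_split; apply: eq_bigr => a _ /=.
rewrite arrival_weight_rcons.
case: (a < x)%N; rewrite ?expr1 ?expr0 /=; ring.
Qed.

(** Moving the Hecke operator from the summand to the kernel turns the relations below into
    identities between coefficients. *)
Lemma hecke_adjoint (K F : 'I_n -> 'I_n -> A) :
  \sum_b \sum_a K b a * (heckeD b a * F b a + heckeO b a * F a b) =
  \sum_b \sum_a (K b a * heckeD b a + K a b * heckeO a b) * F b a.
Proof.
have -> : \sum_b \sum_a K b a * (heckeD b a * F b a + heckeO b a * F a b) =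
   \sum_b \sum_a K b a * heckeD b a * F b a + \sum_b \sum_a K b a * heckeO b a * F a b.
  rewrite -big_split; apply: eq_bigr => b _; rewrite -big_split.
  by apply: eq_bigr => a _ /=; rewrite mulrDr !mulrA.
rewrite [X in _ + X]exchange_big -big_split; apply: eq_bigr => b _.
by rewrite -big_split; apply: eq_bigr => a _; rewrite mulrDl.
Qed.

(** Let [a] depart before [b]. On the left [a] is compared with [x] and [b] still waits, giving
    [a < x] z^[b < x]; on the right [a] is gone and [b] is compared, giving [b < x]. The transposed
    Hecke operator sends the second kernel to the first. *)
Lemma pop_exch f x s :
  pop (exch f) (x :: s) = exch (pop (hecke (size s) f)) (x :: s).
Proof.
rewrite /pop /=.
pose F b a := f (s ++ [:: b; a]).
transitivity (arrival_weight x s * \sum_(b : 'I_n) \sum_(a : 'I_n) (z ^+ (b < x)%N * (a < x)%N%:R) * F b a).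
  rewrite mulr_sumr; apply: eq_bigr => b _; rewrite arrival_weight_rcons.
  rewrite !mulr_sumr; apply: eq_bigr => a _; rewrite -!cats1 -catA /F /=; ring.
congr (_ * _); symmetry.
transitivity (\sum_(b : 'I_n) \sum_(a : 'I_n) ((b < x)%N%:R : A) * (heckeD b a * F b a + heckeO b a * F a b)).
  apply: eq_bigr => b _; rewrite mulr_sumr; apply: eq_bigr => a _.
  by rewrite -!cats1 -catA hecke_cat.
rewrite (hecke_adjoint (fun b _ => ((b < x)%N%:R : A))).
apply: eq_bigr => b _; apply: eq_bigr => a _; congr (_ * _).
rewrite /heckeD /heckeO.
case: (ltngtP a b) => ab; case: (ltnP b x) => bx; case: (ltnP a x) => ax /=;
  try (exfalso; lia); rewrite ?expr1 ?expr0; ring.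
Qed.

(** Up to a symmetric factor the pair has weight z^[a < b], an eigenvector for the eigenvalue z. *)
Lemma hecke_push_push f b a s :
  hecke 0 (push (push f)) (b :: a :: s) = z * push (push f) (b :: a :: s).
Proof.
rewrite /= /heckeD /heckeO !arrival_weight_cons.
by case: (ltngtP a b) => [ab|ab|/val_inj ->] /=; rewrite ?ltnn ?expr1 ?expr0; ring.
Qed.

(** Exactly one of the two arrivals expels an entry [c]; the Hecke operator changes which one, as a
    check over the relative orders of [a], [b], [c] shows. *)
Lemma hecke_push_exch f b a s :
  hecke 0 (push (exch f)) (b :: a :: s) = exch (push f) (b :: a :: s).
Proof.
rewrite /= !arrival_weight_cons !mulr_sumr -big_split.
apply: eq_bigr => c _ /=; rewrite arrival_weight_rcons /heckeD /heckeO.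
case: (ltngtP a b) => [ab|ab|/val_inj ->] /=; rewrite ?ltnn /=.
- case: (ltnP c a) => ca; case: (ltnP c b) => cb /=; try (exfalso; lia);
  rewrite ?expr1 ?expr0; ring.
- case: (ltnP c a) => ca; case: (ltnP c b) => cb /=; try (exfalso; lia);
  rewrite ?expr1 ?expr0; ring.
- case: (ltnP c b) => ca; rewrite /= ?expr1 ?expr0; ring.
Qed.

(** Two exchanges turn the two oldest entries into the two newest; the Hecke operator on the new
    pair becomes the one on the old pair. *)
Lemma hecke_exch_exch f b a s :
  hecke 0 (exch (exch f)) (b :: a :: s) =
  exch (exch (hecke (size s) f)) (b :: a :: s).
Proof.
pose F d c := f (s ++ [:: d; c]).
(* First [a] arrives and expels [c] while [d] still waits; then [b] arrives and expels [d] while [a]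
   waits. *)
pose K (b a d c : 'I_n) : A := z ^+ (a < b)%N * z ^+ (d < a)%N * (d < b)%N%:R * (c < a)%N%:R.
have exchE g b' a' : exch (exch g) (b' :: a' :: s) =
    arrival_weight b' s * arrival_weight a' s *
    \sum_d \sum_c K b' a' d c * g (s ++ [:: d; c]).
  rewrite /= arrival_weight_cons !mulr_sumr; apply: eq_bigr => d _.
  rewrite arrival_weight_rcons !mulr_sumr; apply: eq_bigr => c _.
  rewrite -!cats1 -catA /K /=; ring.
have exchH : exch (exch (hecke (size s) f)) (b :: a :: s) =
    arrival_weight b s * arrival_weight a s *
    \sum_d \sum_c (K b a d c * heckeD d c + K b a c d * heckeO c d) * F d c.
  rewrite exchE -hecke_adjoint; congr (_ * _); apply: eq_bigr => d _.
  by apply: eq_bigr => c _; rewrite hecke_cat.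
rewrite exchH /hecke !exchE !mulr_sumr -big_split; apply: eq_bigr => d _ /=.
rewrite !mulr_sumr -big_split; apply: eq_bigr => c _ /=; rewrite -/(F d c).
set wa := arrival_weight a s; set wb := arrival_weight b s.
(* The kernel [K] intertwines the two Hecke matrices: a finite check over the relative orders of
   four entries. *)
suff E : heckeD b a * K b a d c + heckeO b a * K a b d c =
         K b a d c * heckeD d c + K b a c d * heckeO c d.
  by rewrite -E; ring.
rewrite /K /heckeD /heckeO {exchH exchE F}.
case: (ltngtP a b) => ab; case: (ltngtP c d) => cd;
case: (ltnP c a) => ca; case: (ltnP c b) => cb; try (exfalso; lia);
case: (ltnP d a) => da; case: (ltnP d b) => db; try (exfalso; lia);
rewrite /= ?expr1 ?expr0; ring.
Qed.

Lemma hecke_quadratic f b a s :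
  hecke 0 (hecke 0 f) (b :: a :: s) =
  (z - 1) * hecke 0 f (b :: a :: s) + z * f (b :: a :: s).
Proof.
rewrite /= /heckeD /heckeO.
by case: (ltngtP a b) => [ab|ab|/val_inj ->] /=; ring.
Qed.

End QueueOperators.

(** * Iterated sums over sequences of fixed length *)

Fixpoint isum (A : nmodType) (n : nat) k (F : seq 'I_n -> A) : A :=
  if k is j.+1 then \sum_a isum j (fun h => F (a :: h)) else F [::].

Section IteratedSums.

Variables (A : comNzRingType) (n : nat).
Implicit Types F G : seq 'I_n -> A.

Lemma eq_isum k F G :
  (forall h, size h = k -> F h = G h) -> isum k F = isum k G.
Proof.
elim: k F G => [|k IHk] F G FG /=; first exact: FG.
by apply: eq_bigr => a _; apply: IHk => h sh; apply: FG; rewrite /= sh.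
Qed.

Lemma isum_mull k (u : A) F : isum k (fun h => u * F h) = u * isum k F.
Proof.
elim: k F => [|k IHk] F //=; rewrite mulr_sumr.
by apply: eq_bigr => a _; apply: IHk.
Qed.

Lemma isum_tuple k F : isum k F = \sum_(h : k.-tuple 'I_n) F h.
Proof.
elim: k F => [|k IHk] F /=.
  by rewrite (big_pred1 [tuple]) // => h; apply/esym/eqP/tuple0.
rewrite (reindex (fun p : 'I_n * k.-tuple 'I_n => [tuple of p.1 :: p.2])) /=; last first.
  exists (fun h : k.+1.-tuple 'I_n => (thead h, [tuple of behead h])) => [[a h] _|h _] /=.
    by rewrite theadE; congr (_, _); apply: val_inj.
  by rewrite [RHS]tuple_eta; apply: val_inj.
rewrite -(pair_big xpredT xpredT (fun a (h : k.-tuple 'I_n) => F (a :: h))) /=.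
by apply: eq_bigr => a _; apply: IHk.
Qed.

End IteratedSums.

(** * Positive combinations, uniform in the number of variables *)

Section Cone.

Variables (R : comNzRingType) (P : R -> Prop) (z : R).
Hypotheses (P1 : P 1) (PM : forall a b, P a -> P b -> P (a * b)).
Hypotheses (Pz : P z) (Pz1 : P (z - 1)).

Definition family := forall n, seq 'I_n -> {mpoly R[n]}.

Implicit Types (f g : family) (G : family -> Prop) (w : seq bool).

Definition eq_family m f g :=
  forall n (s : seq 'I_n), size s = m -> f n s = g n s.

Definition fpush f : family := fun n => push z%:MP (fun i => 'X_i) (f n).
Definition fexch f : family := fun n => exch z%:MP (fun i => 'X_i) (f n).
Definition fpop f : family := fun n => pop (f n).
Definition fhecke i f : family := fun n => hecke z%:MP i (f n).

Arguments fpush : clear implicits.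
Arguments fexch : clear implicits.
Arguments fpop : clear implicits.
Arguments fhecke : clear implicits.

(** The coefficients are chosen before [n], as an expansion in Lambda requires, and only the values
    on queues of size [m] count. *)
Inductive cone G m : family -> Prop :=
| cone_zero f : eq_family m f (fun _ _ => 0) -> cone G m f
| cone_step f c g h : P c -> G g -> cone G m h ->
    eq_family m f (fun n s => c%:MP * g n s + h n s) -> cone G m f.

Lemma cone_eq G m f g : eq_family m f g -> cone G m g -> cone G m f.
Proof.
move=> fg cg; case: cg fg => [g' g0|g' c g1 h Pc Gg1 ch gE] fg.
  by apply: cone_zero => n s sz; rewrite fg ?g0.
by apply: (cone_step Pc Gg1 ch) => n s sz; rewrite fg ?gE.
Qed.

Lemma cone_gen G m g : G g -> cone G m g.
Proof.
move=> Gg; apply: (cone_step (h := fun _ _ => 0) P1 Gg); first exact: cone_zero.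
by move=> n s _; rewrite mpolyC1 mul1r addr0.
Qed.

Lemma cone_add G m f g :
  cone G m f -> cone G m g -> cone G m (fun n s => f n s + g n s).
Proof.
move=> cf cg; elim: cf => [f' f0|f' c g1 h Pc Gg1 _ IH fE].
  by apply: cone_eq cg => n s sz; rewrite f0 // add0r.
by apply: (cone_step Pc Gg1 IH) => n s sz; rewrite fE // addrA.
Qed.

Lemma cone_scale G m c f :
  P c -> cone G m f -> cone G m (fun n s => c%:MP * f n s).
Proof.
move=> Pc; elim=> [f' f0|f' d g1 h Pd Gg1 _ IH fE].
  by apply: cone_zero => n s sz; rewrite f0 // mulr0.
apply: (cone_step (PM Pc Pd) Gg1 IH) => n s sz.
by rewrite fE // mulrDr mulrA mpolyCM.
Qed.

(** The scalar may vary with [n], so that elementary symmetric polynomials can be pulled out as well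
    as constants. *)
Definition family_linear m m' (Phi : family -> family) :=
  (forall f g, eq_family m f g -> eq_family m' (Phi f) (Phi g)) /\
  (forall (a : forall n, {mpoly R[n]}) f g,
     eq_family m' (Phi (fun n s => a n * f n s + g n s))
                  (fun n s => a n * Phi f n s + Phi g n s)).

Lemma family_linear0 m m' Phi :
  family_linear m m' Phi -> eq_family m' (Phi (fun _ _ => 0)) (fun _ _ => 0).
Proof.
move=> [PhiE PhiL] n s sz.
have := PhiL (fun n => 1) (fun _ _ => 0) (fun _ _ => 0) n s sz.
rewrite (PhiE _ (fun _ _ => 0)) //; last by move=> k t _; rewrite mulr0 addr0.
by move/eqP; rewrite mul1r -subr_eq subrr => /eqP.
Qed.

Lemma linear_mul m m' Phi (a : forall n, {mpoly R[n]}) f : family_linear m m' Phi ->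
  eq_family m' (Phi (fun n s => a n * f n s)) (fun n s => a n * Phi f n s).
Proof.
move=> PhiP n s sz; have [PhiE PhiL] := PhiP.
have := PhiL a f (fun _ _ => 0) n s sz; rewrite (family_linear0 PhiP) // addr0 => <-.
by apply: PhiE => // k t _; rewrite addr0.
Qed.

Lemma cone_map G G' m m' Phi f :
    family_linear m m' Phi -> (forall g, G g -> cone G' m' (Phi g)) ->
  cone G m f -> cone G' m' (Phi f).
Proof.
move=> PhiP GG'; have [PhiE PhiL] := PhiP; elim=> [f' f0|f' c g1 h Pc Gg1 _ IH fE].
  by apply: cone_zero => n s sz; rewrite (PhiE _ _ f0) // (family_linear0 PhiP).
apply: cone_eq (cone_add (cone_scale Pc (GG' _ Gg1)) IH) => n s sz.
by rewrite (PhiE _ _ fE) // (PhiL (fun n => c%:MP)).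
Qed.

Lemma fpush_linear m : family_linear m m.+1 fpush.
Proof.
split=> [f g fg n [|x s] //= [sz]|a f g n [|x s] //= _]; first by rewrite fg.
ring.
Qed.

Lemma fexch_linear m : family_linear m.+1 m.+1 fexch.
Proof.
split=> [f g fg n [|x s] //= [sz]|a f g n [|x s] //= _].
  by congr (_ * _); apply: eq_bigr => b _; rewrite fg // size_rcons sz.
rewrite mulrCA -mulrDr; congr (_ * _); rewrite mulr_sumr -big_split.
by apply: eq_bigr => b _ /=; ring.
Qed.

Lemma fpop_linear m : family_linear m.+1 m fpop.
Proof.
split=> [f g fg n s sz|a f g n s _]; rewrite /fpop /pop.
  by apply: eq_bigr => b _; rewrite fg // size_rcons sz.
by rewrite mulr_sumr -big_split.
Qed.

Lemma mul_linear (a : forall n, {mpoly R[n]}) m :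
  family_linear m m (fun f n s => a n * f n s).
Proof.
split=> [f g fg n s sz|b f g n s _]; first by rewrite fg.
ring.
Qed.

(* Letters are stored latest first. *)
Fixpoint word_family w : family :=
  match w with
  | [::] => fun _ s => (s == [::])%:R
  | b :: w' => if b then fpush (word_family w') else fexch (word_family w')
  end.

Arguments word_family : clear implicits.

(** Exchanges preserve the size of the queue, so an exchange finds an entry to expel as soon as some
    arrival precedes it. *)
Fixpoint valid_word w : bool :=
  if w is b :: w' then (b || (true \in w')) && valid_word w' else true.

(** The length is recorded because the elimination of departures is an induction on it. *)
Definition word_gen m l g :=
  exists w, [/\ valid_word w, count id w = m, size w = l & g = word_family w].

Lemma word_gen_push m l f :
  cone (word_gen m l) m f -> cone (word_gen m.+1 l.+1) m.+1 (fpush f).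
Proof.
apply: (cone_map (fpush_linear m)) => _ [w [vw cw sw ->]].
by apply: cone_gen; exists (true :: w); rewrite /= cw sw.
Qed.

Lemma word_gen_exch m l f :
  cone (word_gen m.+1 l) m.+1 f -> cone (word_gen m.+1 l.+1) m.+1 (fexch f).
Proof.
apply: (cone_map (fexch_linear m)) => _ [w [vw cw sw ->]].
apply: cone_gen; exists (false :: w); rewrite /= cw sw vw andbT; split=> //.
by rewrite -has_pred1 (eq_has (a2 := id)) ?has_count ?cw // => -[].
Qed.

(** The Hecke operator passes the latest letter unless it touches the newest entry. In that case the
    two latest letters created its pair, or, if both are exchanges, it moves to the pair they
    expelled. *)
Lemma cone_hecke_word l w i :
    (size w <= l)%N -> valid_word w -> (i.+1 < count id w)%N ->
  cone (word_gen (count id w) (size w)) (count id w) (fhecke i (word_family w)).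
Proof.
elim: l w i => [|l IHl] [|b w] i //=; rewrite ltnS => swl /andP[bw vw].
have mem_true u : (0 < count id u)%N -> true \in u.
  by rewrite -has_count -has_pred1 => ?; rewrite (eq_has (a2 := id)) // => -[].
case: i => [|i]; last first.
  case: b bw => /= [_|cw0]; rewrite ?add1n ?add0n => iw.
    apply: cone_eq (word_gen_push (IHl _ i swl vw _)) => // n [|x s] // _.
    exact: hecke_push.
  have {}cw0 : (0 < count id w)%N by apply: leq_trans iw.
  have := IHl _ i swl vw (ltnW iw).
  case: (count id w) cw0 iw => // m _ im cw.
  apply: cone_eq (word_gen_exch cw) => n [|x s] //= [sz].
  by apply: hecke_exch; rewrite sz.
case: w swl bw vw => [|c w] /=; first by case: b.
move=> swl bw /andP[cw vw].
case: b bw => bw; case: c cw bw => cw bw /=; rewrite ?add1n ?add0n => cnt.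
- apply: (cone_eq (g := fun n s => z%:MP * fpush (fpush (word_family w)) n s)).
    by move=> n [|x [|y s]] // _; apply: hecke_push_push.
  apply: cone_scale => //; apply: cone_gen.
  by exists [:: true, true & w].
- apply: (cone_eq (g := fexch (fpush (word_family w)))).
    move=> n [|x [|y s]] // sz; last exact: hecke_push_exch.
    by move: cnt; case: sz => <-.
  by apply: cone_gen; exists [:: false, true & w].
- apply: (cone_eq (g := fun n s => (z - 1)%:MP * fexch (fpush (word_family w)) n s
                    + z%:MP * fpush (fexch (word_family w)) n s)); last first.
    apply: cone_add; apply: cone_scale => //; apply: cone_gen.
      by exists [:: false, true & w].
    exists [:: true, false & w]; rewrite /= vw andbT; split=> //.
    by rewrite mem_true.
  move=> n s sz; rewrite mpolyCB mpolyC1.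
  (* An exchange after an arrival is already a Hecke image, so a second application calls for the
     quadratic relation. *)
  have pe (t : seq 'I_n) : size t = (count id w).+1 -> fexch (fpush (word_family w)) n t =
     hecke z%:MP 0 (fpush (fexch (word_family w)) n) t.
    case: t => [|x [|y t]] // st; last exact/esym/hecke_push_exch.
    by move: cnt; case: st => <-.
  rewrite /fhecke (eq_hecke _ 0 pe) // pe //.
  case: s sz => [|x [|y s]] // sz; last by rewrite hecke_quadratic.
  by move: cnt; case: sz => <-.
- case E : (count id w) cnt => [|[|m]] // _.
  (* The expelled pair sits at indices [m] and [m.+1], the end of the queue left by [w]. *)
  have lm : (m.+1 < count id w)%N by rewrite E.
  have := IHl w m (ltnW swl) vw lm; rewrite E => cw2.
  apply: cone_eq (word_gen_exch (word_gen_exch cw2)) => n [|x [|y s]] //= [sz].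
  by rewrite -sz; apply: hecke_exch_exch.
Qed.

(** * Elimination of departures in favour of elementary symmetric polynomials *)

Definition esym_prod (lam : seq nat) n : {mpoly R[n]} := \prod_(r <- lam) mesym n R r.

Definition esym_gen m g := exists lam w, [/\ valid_word w, count id w = m
  & g = fun n s => esym_prod lam n * word_family w n s].

Lemma cone_word w : valid_word w ->
  cone (esym_gen (count id w)) (count id w) (word_family w).
Proof.
move=> vw; apply: (cone_eq (g := fun n s => esym_prod [::] n * word_family w n s)).
  by move=> n s _; rewrite /esym_prod big_nil mul1r.
by apply: cone_gen; exists [::], w.
Qed.

Lemma cone_esym_mul lam m f : cone (esym_gen m) m f ->
  cone (esym_gen m) m (fun n s => esym_prod lam n * f n s).
Proof.
apply: (cone_map (mul_linear _ m)) => _ [mu [w [vw cw ->]]].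
apply: (cone_eq (g := fun n s => esym_prod (lam ++ mu) n * word_family w n s)).
  by move=> n s _; rewrite /esym_prod big_cat mulrA.
by apply: cone_gen; exists (lam ++ mu), w.
Qed.

Lemma cone_esym_map m m' Phi f : family_linear m m' Phi ->
    (forall w, valid_word w -> count id w = m ->
       cone (esym_gen m') m' (Phi (word_family w))) ->
  cone (esym_gen m) m f -> cone (esym_gen m') m' (Phi f).
Proof.
move=> PhiL wP; apply: (cone_map PhiL) => _ [lam [w [vw cw ->]]].
apply: cone_eq (cone_esym_mul lam (wP w vw cw)).
exact: linear_mul PhiL.
Qed.

Lemma cone_push m f :
  cone (esym_gen m) m f -> cone (esym_gen m.+1) m.+1 (fpush f).
Proof.
apply: (cone_esym_map (fpush_linear m)) => w vw cw.
by have := @cone_word (true :: w) vw; rewrite /= cw.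
Qed.

Lemma cone_exch m f :
  cone (esym_gen m.+1) m.+1 f -> cone (esym_gen m.+1) m.+1 (fexch f).
Proof.
apply: (cone_esym_map (fexch_linear m)) => w vw cw.
have := @cone_word (false :: w); rewrite /= vw cw andbT; apply.
by rewrite -has_pred1 (eq_has (a2 := id)) ?has_count ?cw // => -[].
Qed.

(** Each exchange replaces the only entry by a larger one. Nothing else is waiting, so no power of z
    appears. *)
Lemma word_familyD n (x : 'I_n) a :
  word_family (ncons a false [:: true]) n [:: x] =
  isum a (fun h => (path gtn x (map val h))%:R * \prod_(i <- x :: h) 'X_i).
Proof.
elim: a x => [|a IHa] x /=.
  by rewrite /fpush /= /arrival_weight /= mul1r big_seq1 mul1r mulr1.
rewrite /fexch /= /arrival_weight /= mul1r mulr_sumr.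
apply: eq_bigr => y _; rewrite IHa -!isum_mull.
apply: eq_isum => h _; rewrite !big_cons.
by case: (y < x)%N => /=; ring.
Qed.

Lemma fpop_chain a n :
  fpop (word_family (ncons a false [:: true])) n [::] = mesym n R a.+1.
Proof.
rewrite mesym_tupleE /fpop /pop /=.
transitivity (isum a.+1 (fun h : seq 'I_n =>
    (sorted gtn (map val h))%:R * \prod_(i <- h) 'X_i : {mpoly R[n]})).
  by apply: eq_bigr => x _; rewrite word_familyD.
(* Histories run from newest to oldest and decrease, whereas [mesym_tupleE] sums over increasing
   tuples. *)
have rev_tupleK : involutive (fun h : a.+1.-tuple 'I_n => [tuple of rev h]).
  by move=> h; apply: val_inj; rewrite /= revK.
rewrite isum_tuple (reindex_inj (inv_inj rev_tupleK)) [RHS]big_mkcond.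
apply: eq_bigr => h _ /=; rewrite map_rev rev_sorted /tmono.
rewrite (perm_big h) /= ?perm_rev //.
rewrite [X in (nat_of_bool X)%:R](_ : _ = sorted ltn (map val h)) //.
by case: sorted; rewrite ?mul1r ?mul0r.
Qed.

Lemma valid_word_count0 w : valid_word w -> count id w = 0%N -> w = [::].
Proof.
case: w => [|[] w] //= /andP[tw _] /eqP; rewrite add0n => /eqP c0.
suff: has id w by rewrite has_count c0.
by apply/hasP; exists true.
Qed.

Lemma valid_word_count1 w : valid_word w -> count id w = 1%N ->
  w = ncons (size w).-1 false [:: true].
Proof.
elim: w => [|[] w IHw] //= => [vw [cw]|/andP[tw vw] cw].
  by rewrite (valid_word_count0 vw cw).
by rewrite {1}(IHw vw cw); case: w {IHw cw vw} tw.
Qed.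

(** Induction on the length: the departure moves past the latest letter until only one entry is in
    the queue, where the word is a chain N D^a. *)
Lemma cone_pop_word m w : valid_word w -> count id w = m.+1 ->
  cone (esym_gen m) m (fpop (word_family w)).
Proof.
have [l] := ubnP (size w); elim: l w m => [|l IHl] w m // swl vw cw.
have chain u : valid_word u -> count id u = 1%N ->
    cone (esym_gen 0) 0 (fpop (word_family u)).
  move=> vu cu.
  apply: (cone_eq (g := fun n s => esym_prod [:: (size u).-1.+1] n * word_family [::] n s)).
    move=> n [|//] _; rewrite {1}(valid_word_count1 vu cu) fpop_chain.
    by rewrite /esym_prod big_seq1 mulr1.
  by apply: cone_gen; exists [:: (size u).-1.+1], [::].
case: w swl vw cw => [|[] w] //= swl vw.
- rewrite add1n; case: m => [|m] [cw].
    by apply: (chain (true :: w)); rewrite /= ?add1n ?cw.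
  apply: (cone_eq (g := fun n s => fpush (fpop (word_family w)) n s
                      + (z - 1)%:MP * fexch (word_family w) n s)).
    by move=> n [|x s] // _; rewrite mpolyCB mpolyC1; apply: pop_push.
  apply: cone_add; first by apply: cone_push; apply: IHl.
  apply: cone_scale => //; apply: cone_exch; rewrite -cw; exact: cone_word.
- case/andP: vw => tw vw.
  case: m => [|m] cw; first by apply: (chain (false :: w)); rewrite /= ?vw ?tw ?cw.
  rewrite add0n in cw.
  apply: (cone_eq (g := fexch (fpop (fhecke m (word_family w))))).
    by move=> n [|x s] // [<-]; apply: pop_exch.
  apply: cone_exch.
  have lm : (m.+1 < count id w)%N by rewrite cw.
  have := cone_hecke_word (leqnn _) vw lm; rewrite cw.
  (* The words [u] are as long as the tail [w], hence shorter than the word being treated. *)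
  apply: (cone_map (fpop_linear m.+1)) => _ [u [vu cu su ->]].
  by apply: IHl; rewrite ?su.
Qed.

Lemma cone_pop m f : cone (esym_gen m.+1) m.+1 f -> cone (esym_gen m) m (fpop f).
Proof. by apply: (cone_esym_map (fpop_linear m)) => w; apply: cone_pop_word. Qed.

End Cone.

(** * Runs of the queue as sums over histories *)

Section Histories.

Variables (A : comNzRingType) (n : nat) (z : A) (X : 'I_n -> A).
Implicit Types (w : seq (bool * bool)) (s h : seq 'I_n).

(* A letter [(d, a)] says whether the oldest element departs and whether a new
   one arrives; letters are stored latest first. *)
Fixpoint run w : seq 'I_n -> A :=
  match w with
  | [::] => fun s => (s == [::])%:R
  | (true, true) :: w' => exch z X (run w')
  | (true, false) :: w' => pop (run w')
  | (false, true) :: w' => push z X (run w')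
  | (false, false) :: w' => run w'
  end.

Fixpoint queue_size w : nat :=
  if w is (d, a) :: w' then (a + (queue_size w' - d))%N else 0.

Fixpoint admissible w : bool :=
  if w is (d, a) :: w' then (d <= queue_size w')%N && admissible w' else true.

(** All arrivals are listed in [h], newest first. First in, first out makes the current queue a
    prefix of the list, so its oldest entry is at index [(queue_size w').-1]. *)
Fixpoint history_weight w h : A :=
  match w with
  | [::] => 1
  | (d, true) :: w' =>
      if h is x :: h' then
        (if d then (nth x h' (queue_size w').-1 < x)%N%:R else 1) *
        arrival_weight z X x (take (queue_size w' - d) h') * history_weight w' h'
      else 0
  | (_, false) :: w' => history_weight w' h
  end.

Lemma queue_size_le w : (queue_size w <= count snd w)%N.
Proof. by elim: w => [|[[] []] w IHw] //=; lia. Qed.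

(** The sum is over the departed entries: each departure puts one back just behind the queue, which
    is its place in the history. *)
Lemma run_isum w s : admissible w -> size s = queue_size w ->
  run w s = isum (count snd w - queue_size w) (fun h => history_weight w (s ++ h)).
Proof.
elim: w s => [|[[] []] w IHw] s //=.
- by move=> _ /size0nil ->.
- move=> /andP[q0 aw]; have qc := queue_size_le w.
  case: s => [|x s] // [sz].
  have -> : (1 + count snd w - (1 + (queue_size w - 1)) = (count snd w - queue_size w).+1)%N by lia.
  rewrite /= mulr_sumr; apply: eq_bigr => a _.
  rewrite IHw //; last by rewrite size_rcons; lia.
  rewrite -!isum_mull; apply: eq_isum => h _.
  have szq : size s = (queue_size w).-1 by lia.
  by rewrite cat_rcons nth_cat -szq ltnn subnn /= subn1 -szq take_size_cat //; ring.
- move=> /andP[q0 aw]; have qc := queue_size_le w => sz.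
  have -> : (0 + count snd w - (0 + (queue_size w - 1)) = (count snd w - queue_size w).+1)%N by lia.
  apply: eq_bigr => a _; rewrite IHw //; last by rewrite size_rcons; lia.
  by apply: eq_isum => h _; rewrite cat_rcons.
- move=> aw; have qc := queue_size_le w.
  case: s => [|x s] // [sz].
  rewrite /= !subn0 in sz *.
  rewrite IHw // !add1n subSS -isum_mull; apply: eq_isum => h _.
  by rewrite take_size_cat // mul1r.
- by move=> aw; rewrite add0n subn0 => sz; apply: IHw.
Qed.

End Histories.

(** * The sweep of the cells of the strips *)

Section StripCells.

Variables (k : nat) (nu : k.-tuple vstrip).
Implicit Types (u v : cell nu).

Definition col_sum : nat := \sum_(i < k) vs_col (tnth nu i).

(** The content, shifted by [col_sum] so as to be a natural number. *)
Definition level u : nat :=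
  (vs_row (tnth nu (tag u)) + tagged u + (col_sum - vs_col (tnth nu (tag u))))%N.

(* The entries inverted with a larger entry at [v] lie in cells less than [k.+1]
   units of time before [v], and the cell just below [v] exactly [k.+1] units. *)
Definition time u : nat := (level u * k.+1 + tag u)%N.

Lemma level_content u : (level u)%:Z = content u + col_sum%:Z.
Proof.
have : (vs_col (tnth nu (tag u)) <= col_sum)%N.
  by rewrite /col_sum (bigD1 (tag u)) //= leq_addr.
rewrite /level /content; lia.
Qed.

(** Rows start at 1, so the window of times below [k.+1] is empty and the sweep starts from the
    empty queue. *)
Lemma time_ge u : (k.+1 <= time u)%N.
Proof.
have l0 : (0 < level u)%N.
  by have := vs_row_gt0 (tnth nu (tag u)); rewrite /level; lia.
by rewrite /time (leq_trans (leq_pmull k.+1 l0)) // leq_addr.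
Qed.

Lemma time_window u v :
  (time v < time u + k.+1)%N && (time u < time v)%N =
  (tag u < tag v)%N && (content u == content v)
  || (tag v < tag u)%N && (content v == content u + 1).
Proof.
have -> : (content u == content v) = (level u == level v).
  have := level_content u; have := level_content v; lia.
have -> : (content v == content u + 1) = (level v == (level u).+1).
  have := level_content u; have := level_content v; lia.
have := ltn_ord (tag u); have := ltn_ord (tag v); rewrite /time.
move: (level u) (level v) (nat_of_ord (tag u)) (nat_of_ord (tag v)) => a b i j jk ik.
case: (ltngtP a b) => [|ba|->]; last by lia.
  rewrite leq_eqVlt => /predU1P[<-|ab]; first by rewrite mulSn eqxx; lia.
  have : (a.+2 * k.+1 <= b * k.+1)%N by rewrite leq_mul2r ab orbT.
  rewrite !mulSn; lia.
have : (b.+1 * k.+1 <= a * k.+1)%N by rewrite leq_mul2r ba orbT.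
rewrite !mulSn; lia.
Qed.

Lemma time_below u v :
  (time u + k.+1 == time v)%N = (tag u == tag v) && (level v == (level u).+1).
Proof.
have := ltn_ord (tag u); have := ltn_ord (tag v); rewrite /time -val_eqE /=.
move: (level u) (level v) (nat_of_ord (tag u)) (nat_of_ord (tag v)) => a b i j jk ik.
rewrite addnAC -mulSnr; case: (ltngtP a.+1 b) => [ab|ba|<-]; last by lia.
  have : (a.+2 * k.+1 <= b * k.+1)%N by rewrite leq_mul2r ab orbT.
  rewrite !mulSn; lia.
have : (b.+1 * k.+1 <= a.+1 * k.+1)%N by rewrite leq_mul2r ba orbT.
rewrite !mulSn; lia.
Qed.

Lemma time_inj : injective time.
Proof.
move=> u v tuv.
have tg : tag u = tag v.
  apply: val_inj => /=; move/(congr1 (modn^~ k.+1)): tuv.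
  by rewrite /time !modnMDl !modn_small // ltnS ltnW.
have lv : level u = level v.
  by move: tuv; rewrite /time tg => /eqP; rewrite eqn_add2r eqn_pmul2r // => /eqP.
case: u v tg lv {tuv} => [i a] [j b] /= ij; case: _ / ij b => b.
rewrite /level /= => /eqP; rewrite eqn_add2r eqn_add2l => /eqP ab.
by congr (Tagged _ _); apply: val_inj.
Qed.

Definition cell_at t : option (cell nu) := [pick u | time u == t].

Lemma cell_atK : ocancel cell_at time.
Proof. by move=> t; rewrite /cell_at; case: pickP => [u /eqP|]. Qed.

Lemma timeK : pcancel time cell_at.
Proof.
move=> u; rewrite /cell_at; case: pickP => [v /eqP /time_inj ->//|/(_ u)].
by rewrite eqxx.
Qed.

Lemma cell_atP t u : cell_at t = Some u -> time u = t.
Proof. by move=> tu; have := cell_atK t; rewrite tu. Qed.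

Definition cells_between a b := pmap cell_at (rev (iota a (b - a))).

Lemma mem_cells_between a b u : (a <= b)%N ->
  (u \in cells_between a b) = (a <= time u < b)%N.
Proof.
by move=> ab; rewrite (can2_mem_pmap cell_atK timeK) mem_rev mem_iota subnKC.
Qed.

Lemma cells_between_uniq a b : uniq (cells_between a b).
Proof. by apply: (pmap_uniq cell_atK); rewrite rev_uniq iota_uniq. Qed.

Lemma cells_between_cat a b c : (a <= b <= c)%N ->
  cells_between a c = cells_between b c ++ cells_between a b.
Proof.
move=> /andP[ab bc]; rewrite /cells_between -pmap_cat -rev_cat.
have -> : (c - a = (b - a) + (c - b))%N by lia.
by rewrite iotaD subnKC.
Qed.

Lemma cells_between1 a : cells_between a a.+1 = seq_of_opt (cell_at a).
Proof. by rewrite /cells_between subSnn /=; case: cell_at. Qed.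

(** After [r] steps the queue holds the cells with times from [r] to [r + k]. If a departure and an
    arrival coincide, the departing cell is the one just below the arriving cell, and the comparison
    in [exch] is the strictness of the column. *)
Fixpoint sweep r : seq (bool * bool) :=
  if r is r'.+1 then (isSome (cell_at r'), isSome (cell_at (r' + k.+1)%N)) :: sweep r'
  else [::].

Lemma cells_between_early b : (b <= k.+1)%N -> cells_between 0 b = [::].
Proof.
move=> bk; case E: (cells_between 0 b) => [|u s] //.
have : u \in cells_between 0 b by rewrite E mem_head.
rewrite mem_cells_between //; have := time_ge u; lia.
Qed.

Lemma queue_split r : cells_between r (r + k.+1)%N =
  cells_between r.+1 (r + k.+1)%N ++ seq_of_opt (cell_at r).
Proof. by rewrite -cells_between1 -cells_between_cat //; lia. Qed.

Lemma queue_next r : cells_between r.+1 (r.+1 + k.+1)%N =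
  seq_of_opt (cell_at (r + k.+1)%N) ++ cells_between r.+1 (r + k.+1)%N.
Proof. by rewrite -cells_between1 -cells_between_cat //; lia. Qed.

Lemma size_seq_of_opt (T : Type) (o : option T) : size (seq_of_opt o) = isSome o.
Proof. by case: o. Qed.

Lemma sweep_queue r : queue_size (sweep r) = size (cells_between r (r + k.+1)%N).
Proof.
elim: r => [|r IHr] /=; first by rewrite add0n cells_between_early.
by rewrite IHr queue_next queue_split !size_cat !size_seq_of_opt addnK.
Qed.

Lemma sweep_admissible r : admissible (sweep r).
Proof.
elim: r => [|r IHr] //=; rewrite IHr sweep_queue queue_split size_cat.
by rewrite size_seq_of_opt leq_addl.
Qed.

Lemma history_split r : cells_between 0 (r + k.+1)%N =
  cells_between r.+1 (r + k.+1)%N ++ seq_of_opt (cell_at r) ++ cells_between 0 r.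
Proof. by rewrite catA -queue_split -cells_between_cat //; lia. Qed.

Lemma history_next r : cells_between 0 (r.+1 + k.+1)%N =
  seq_of_opt (cell_at (r + k.+1)%N) ++ cells_between 0 (r + k.+1)%N.
Proof. by rewrite -cells_between1 -cells_between_cat //; lia. Qed.

Lemma sweep_count r : count snd (sweep r) = size (cells_between 0 (r + k.+1)%N).
Proof.
elim: r => [|r IHr] /=; first by rewrite add0n cells_between_early.
by rewrite history_next size_cat size_seq_of_opt IHr.
Qed.

(** * Weights of fillings as products over cells *)

Section Weights.

Variables (A : comNzRingType) (n : nat) (z : A) (X : 'I_n -> A).
Implicit Types T : filling nu n.

(** Each inversion is charged to the cell with the larger entry, the later one in the sweep. *)
Definition cell_weight T v : A :=
  [forall u, (time u + k.+1 == time v)%N ==> (T u < T v)%N]%:R *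
  (z ^+ #|[set u | is_inversion T u v]| * X (T v)).

Lemma count_inversions T v r : time v = (r + k.+1)%N ->
  count (fun y : 'I_n => (y < T v)%N) (map T (cells_between r.+1 (r + k.+1)%N)) =
  #|[set u | is_inversion T u v]|.
Proof.
move=> tv; rewrite count_map -size_filter.
have /card_uniqP <- := filter_uniq (preim T (fun y : 'I_n => (y < T v)%N))
  (cells_between_uniq r.+1 (r + k.+1)%N).
apply: eq_card => u; rewrite inE mem_filter mem_cells_between; last by lia.
rewrite /is_inversion -time_window tv /=; congr (_ && _).
by rewrite ltn_add2r.
Qed.

Lemma history_weight_sweep T r :
  history_weight z X (sweep r) (map T (cells_between 0 (r + k.+1)%N)) =
  \prod_(v <- cells_between 0 (r + k.+1)%N) cell_weight T v.
Proof.
elim: r => [|r IHr]; first by rewrite add0n cells_between_early // big_nil.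
rewrite history_next /=; case E: (cell_at (r + k.+1)%N) => [v|] /=; last first.
  by rewrite -IHr; case: (cell_at r).
have tv := cell_atP E.
rewrite big_cons -IHr sweep_queue queue_split history_split.
case F: (cell_at r) => [u|] /=.
  have tu := cell_atP F.
  rewrite size_cat addnK !map_cat take_size_cat ?size_map //.
  rewrite addn1 nth_cat size_map ltnn subnn /cell_weight -(count_inversions T tv).
  (* As [time] is injective, only the departing cell [u] can lie just below [v]. *)
  congr (_ * _ * _); congr ((nat_of_bool _)%:R); apply/idP/forallP => [uv u'|/(_ u)].
    apply/implyP; rewrite tv eqn_add2r -tu => /eqP /time_inj ->; exact: uv.
  by rewrite tu tv eqxx.
rewrite cats0 subn0 map_cat take_size_cat ?size_map //.
rewrite /cell_weight -(count_inversions T tv).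
(* No cell has time [r], so the condition on the cell below [v] is vacuous. *)
congr (_ * _ * _); rewrite (_ : [forall u, _]) //.
apply/forallP => u; apply/implyP; rewrite tv eqn_add2r => /eqP tu.
by have := timeK u; rewrite tu F.
Qed.

Lemma is_ssyt_time T :
  is_ssyt T = [forall v, forall u, (time u + k.+1 == time v)%N ==> (T u < T v)%N].
Proof.
apply/idP/idP => [/forallP Tss|/forallP Tss].
  apply/forallP => -[j b]; apply/forallP => -[i a]; apply/implyP.
  rewrite time_below /= => /andP[/eqP ij]; case: _ / ij b => b /eqP lb.
  have /forallP/(_ a)/forallP/(_ b)/implyP := Tss i; apply.
  by move: lb; rewrite /level /=; lia.
apply/forallP => i; apply/forallP => a; apply/forallP => b; apply/implyP => ab.
pose c (e : 'I_(vs_height (tnth nu i))) : cell nu :=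
  @existT 'I_k (fun j => 'I_(vs_height (tnth nu j))) i e.
have [d] : exists d, val b = (a + d.+1)%N by exists (b - a.+1)%N; rewrite /=; lia.
(* Adjacent cells suffice, by induction on the gap between the two rows. *)
elim: d b {ab} => [|d IHd] b bE.
  have /forallP/(_ (c a))/implyP := Tss (c b); apply.
  by rewrite time_below eqxx /level /= bE; apply/eqP; lia.
have ca : (a + d.+1 < vs_height (tnth nu i))%N.
  by apply: leq_trans (ltn_ord b); rewrite /= in bE; rewrite bE; lia.
apply: ltn_trans (IHd (Ordinal ca) erefl) _.
have /forallP/(_ (c (Ordinal ca)))/implyP := Tss (c b); apply.
by rewrite time_below eqxx /level /= bE; apply/eqP; lia.
Qed.

Lemma prod_natb (I : finType) (b : I -> bool) :
  \prod_i (b i)%:R = [forall i, b i]%:R :> A.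
Proof.
case: forallP => [bT|/forallP]; first by rewrite big1 // => i _; rewrite bT.
by rewrite negb_forall => /existsP[i /negbTE bi]; rewrite (bigD1 i) //= bi mul0r.
Qed.

Lemma card_inversions T : Defs.inv T = (\sum_v #|[set u | is_inversion T u v]|)%N.
Proof.
rewrite /Defs.inv -sum1_card (eq_bigl (fun p => is_inversion T p.1 p.2)); last first.
  by move=> p; rewrite inE.
rewrite -(pair_big_dep xpredT (fun u v => is_inversion T u v) (fun _ _ => 1%N)) /=.
rewrite (exchange_big_dep xpredT) //=; apply: eq_bigr => v _.
by rewrite -sum1_card; apply: eq_bigl => u; rewrite inE.
Qed.

Lemma prod_cell_weight T :
  \prod_v cell_weight T v = (is_ssyt T)%:R * (z ^+ Defs.inv T * \prod_v X (T v)).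
Proof.
by rewrite !big_split /= prod_natb -is_ssyt_time card_inversions -prodrXr.
Qed.

End Weights.

Lemma sum_fillings (A : comNzRingType) n (us : seq (cell nu)) (F : seq 'I_n -> A) :
    uniq us -> (forall u, u \in us) ->
  \sum_(T : filling nu n) F (map T us) = isum (size us) F.
Proof.
move=> uus usT; rewrite isum_tuple.
have idx_lt u : (index u us < size us)%N by rewrite index_mem.
pose of_tuple (h : (size us).-tuple 'I_n) : filling nu n :=
  [ffun u => tnth h (Ordinal (idx_lt u))].
have of_tupleK (h : (size us).-tuple 'I_n) : map_tuple (of_tuple h) (in_tuple us) = h.
  apply: eq_from_tnth => i; rewrite tnth_map ffunE; congr tnth.
  by apply: val_inj; rewrite /= (tnth_nth (tnth (in_tuple us) i)) index_uniq.
rewrite (reindex of_tuple) /=; last first.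
  exists (fun T : filling nu n => map_tuple T (in_tuple us)) => [h _|T _] //.
  by apply/ffunP => u; rewrite ffunE tnth_map (tnth_nth u) /= nth_index.
by apply: eq_bigr => h _; rewrite -[in RHS](of_tupleK h).
Qed.

Lemma scale_mpolyC_exp n (R : comNzRingType) (x : R) m (p : {mpoly R[n]}) :
  x ^+ m *: p = x%:MP ^+ m * p.
Proof. by rewrite -mul_mpolyC rmorphXn. Qed.

Lemma LLT_run (x : Qqt) : exists r, cells_between r (r + k.+1)%N = [::] /\
  forall n, LLT nu x n = run x%:MP (fun i : 'I_n => 'X_i) (sweep r) [::].
Proof.
(* By this time every cell has arrived and departed. *)
pose r := (\max_u time u).+1.
have ltr u : (time u < r)%N by rewrite ltnS (leq_bigmax u).
have cells_r : cells_between r (r + k.+1)%N = [::].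
  case E: cells_between => [|u s] //.
  have : u \in cells_between r (r + k.+1)%N by rewrite E mem_head.
  rewrite mem_cells_between ?leq_addr //; have := ltr u; lia.
exists r; split=> // n.
rewrite run_isum ?sweep_admissible ?sweep_queue ?cells_r // subn0 sweep_count.
have all_in u : u \in cells_between 0 (r + k.+1)%N.
  by rewrite mem_cells_between //; have := ltr u; lia.
rewrite -sum_fillings ?cells_between_uniq // /LLT big_mkcond; apply: eq_bigr => T _.
rewrite history_weight_sweep [RHS]big_uniq ?cells_between_uniq //=.
rewrite [RHS](eq_bigl xpredT) // prod_cell_weight.
case: is_ssyt; last by rewrite mul0r.
by rewrite mul1r; apply: scale_mpolyC_exp.
Qed.

End StripCells.

(** * Positivity of runs and the passage to e-expansions *)

Lemma cone_run (R : comNzRingType) (P : R -> Prop) (z : R) (w : seq (bool * bool)) :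
    P 1 -> (forall a b, P a -> P b -> P (a * b)) -> P z -> P (z - 1) ->
  admissible w ->
  cone P (esym_gen z (queue_size w)) (queue_size w)
    (fun n => run z%:MP (fun i : 'I_n => 'X_i) w).
Proof.
move=> P1 PM Pz Pz1; elim: w => [_|[d a] w IHw] /=.
  exact: (@cone_word R P z P1 [::]).
move=> /andP[]; case: d => /=.
  move=> q0 /IHw; case: (queue_size w) q0 => // m _; rewrite subSS subn0.
  by case: a => cw; [apply: cone_exch cw | apply: cone_pop cw].
by move=> _ /IHw; rewrite subn0; case: a => //; apply: cone_push.
Qed.

Lemma nat_mpolyP (p : {mpoly rat[2]}) :
  reflect (forall m, p@_m \is a Num.nat) (p \is a mpolyOver 2 Num.nat).
Proof. exact: mpolyOverP. Qed.

Lemma in_Nqt0 : in_Nqt 0.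
Proof.
by exists 0; [apply/nat_mpolyP => m; rewrite mcoeff0 | rewrite tofrac0].
Qed.

Lemma in_Nqt1 : in_Nqt 1.
Proof.
exists 1; last by rewrite tofrac1.
by apply/nat_mpolyP => m; rewrite mcoeff1 natr_nat.
Qed.

Lemma in_NqtD a b : in_Nqt a -> in_Nqt b -> in_Nqt (a + b).
Proof.
move=> [p /nat_mpolyP pN ->] [r /nat_mpolyP rN ->].
exists (p + r); last by rewrite tofracD.
by apply/nat_mpolyP => m; rewrite mcoeffD rpredD.
Qed.

Lemma in_NqtM a b : in_Nqt a -> in_Nqt b -> in_Nqt (a * b).
Proof.
move=> [p /nat_mpolyP pN ->] [r /nat_mpolyP rN ->].
exists (p * r); last by rewrite tofracM.
by apply/nat_mpolyP => m; rewrite mcoeffM rpred_sum // => c _; rewrite rpredM.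
Qed.

Lemma in_Nqt_qvar : in_Nqt qvar.
Proof.
exists 'X_0 => //; apply/nat_mpolyP => m; rewrite mcoeffX; exact: natr_nat.
Qed.

(** Zero parts may be dropped because e_0 = 1. *)
Definition sort_parts (lam : seq nat) : seq nat := sort geq [seq r <- lam | r != 0%N].

Lemma sort_parts_partition lam : is_partition (sort_parts lam).
Proof.
rewrite /is_partition sort_sorted; last by move=> a b; apply: leq_total.
by rewrite mem_sort mem_filter eqxx.
Qed.

Definition intpart_of lam : intpart := IntPart (sort_parts_partition lam).

Lemma e_part_intpart_of lam n : e_part (intpart_of lam) n = esym_prod Qqt lam n.
Proof.
rewrite /e_part /esym_prod /= (perm_big _ (permEl (perm_sort _ _))) big_filter.
rewrite [RHS](bigID (fun r => r != 0%N)) /= [X in _ * X]big1 ?mulr1 // => r.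
by rewrite negbK => /eqP ->; rewrite mesym0E.
Qed.

Lemma e_positive_eq (f g : varseq) : (forall n, f n = g n) ->
  e_positive g -> e_positive f.
Proof. by move=> fg [c ce cN]; exists c => // n; rewrite fg. Qed.

Lemma e_positive0 : e_positive (fun _ => 0).
Proof.
exists [fsfun with 0] => [n|mu]; last by rewrite fsfunE; apply: in_Nqt0.
by rewrite finsupp0 big_seq_fset0.
Qed.

Lemma sum_finsupp_widen (R : nzRingType) (V : lmodType R) (I : choiceType)
    (E : I -> V) (e : {fsfun I -> R with 0}) (S : {fset I}) :
  (finsupp e `<=` S)%fset ->
  \sum_(i <- finsupp e) e i *: E i = \sum_(i <- S) e i *: E i.
Proof.
by move=> eS; apply: big_fset_incl => // i _ /fsfun_dflt ->; apply: scale0r.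
Qed.

Lemma sum_finsupp_add (R : nzRingType) (V : lmodType R) (I : choiceType)
    (E : I -> V) (e : {fsfun I -> R with 0}) (j : I) (c : R) :
  let e' := [fsfun e with j |-> c + e j] in
  \sum_(i <- finsupp e') e' i *: E i = c *: E j + \sum_(i <- finsupp e) e i *: E i.
Proof.
(* The support may gain [j] or lose it if [c + e j] vanishes, so both sums are taken over a common
   set. *)
move=> e'; pose S := (j |` finsupp e)%fset; have jS : j \in S := fset1U1 _ _.
have e'S : (finsupp e' `<=` S)%fset.
  apply/fsubsetP => i; rewrite in_fset1U !mem_finsupp fsfun_withE.
  by case: (i == j).
rewrite (sum_finsupp_widen _ e'S) (sum_finsupp_widen _ (fsubsetUr _ _ : _ `<=` S)%fset).
rewrite (big_fsetD1 j jS) [in RHS](big_fsetD1 j jS) /= fsfun_withE eqxx scalerDl -addrA.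
congr (_ + (_ + _)); apply: eq_big_seq => i; rewrite in_fsetD1 fsfun_withE.
by case: (i == j).
Qed.

Lemma e_positive_add_part c mu (f : varseq) : in_Nqt c -> e_positive f ->
  e_positive (fun n => c *: e_part mu n + f n).
Proof.
move=> cN [d de dN]; exists [fsfun d with mu |-> c + d mu] => [n|nu].
  by rewrite de sum_finsupp_add.
by rewrite fsfun_withE; case: (nu == mu) => //; apply: in_NqtD.
Qed.

(** A valid word that leaves the queue empty is the empty word, so the generators evaluate to
    products of elementary symmetric polynomials. *)
Lemma e_positive_cone f : cone in_Nqt (esym_gen (qvar + 1) 0) 0 f ->
  e_positive (fun n => f n [::]).
Proof.
elim=> [g g0|g c _ h cN [lam [w [vw cw ->]]] _ hpos gE].
  by apply: e_positive_eq e_positive0 => n; apply: g0.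
apply: e_positive_eq (e_positive_add_part (intpart_of lam) cN hpos) => n.
rewrite gE // (valid_word_count0 vw cw) e_part_intpart_of mulr1.
by rewrite mul_mpolyC.
Qed.

Theorem corollary5p7 (k : nat) (nu : k.-tuple vstrip) :
  e_positive (LLT nu (qvar + 1)).
Proof.
have [r [r_end LLTE]] := LLT_run nu (qvar + 1).
apply: (e_positive_eq LLTE).
have qN : in_Nqt (qvar + 1) by apply: in_NqtD in_Nqt_qvar in_Nqt1.
have qN1 : in_Nqt (qvar + 1 - 1) by rewrite addrK; apply: in_Nqt_qvar.
apply: (e_positive_cone (f := fun n => run _ _ (sweep nu r))).
have := cone_run in_Nqt1 in_NqtM qN qN1 (sweep_admissible nu r).
by rewrite sweep_queue r_end.
Qed.
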